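(* Let $n \geq 2$ and let $r$ be the rectangle covering number of the slack matrix of any $n$-gon. Then $$ n \leq \frac{r - \lfloor r/2 \rfloor}{r-1} \binom{r}{\lfloor r/2 \rfloor}. $$
   Context: An $n$-gon is a convex polygon with exactly $n$ vertices (hence $n$ facets, i.e. edges); it need not be regular. For $n=2$ this is understood as the degenerate case of a line segment viewed as a one-dimensional polytope, with two vertices and two facets (its endpoints). Slack matrix: for a polytope $P \subset \mathbb{R}^d$ with $f$ facets described by linear inequalities $a_i^T x \leq b_i$, $1 \leq i \leq f$, and $v$ vertices $x_1,\dots,x_v \in \mathbb{R}^d$, the slack matrix is the nonnegative $f \times v$ matrix $S_P$ with $S_P(i,j) = b_i - a_i^T x_j$. It is defined up to positive scaling of rows and permutation of rows and columns (which do not affect the rectangle covering number). Rectangle covering number: for a nonnegative matrix $M$, a rectangle is a pair $(I,J)$ of a subset $I$ of rows and a subset $J$ of columns such that $M_{ij} > 0$ for all $i \in I$, $j \in J$. The rectangle covering number of $M$ is the minimum number of rectangles needed so that every positive entry $(i,j)$ of $M$ belongs to $I \times J$ for at least one of the chosen rectangles $(I,J)$. *)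

(* Defs.v *)
From mathcomp Require Import all_boot all_order all_algebra.
From mathcomp Require Import boolp classical_sets functions cardinality reals.

Set Implicit Arguments.
Unset Strict Implicit.
Unset Printing Implicit Defensive.

Import Order.TTheory GRing.Theory Num.Theory.

Local Open Scope classical_set_scope.
Local Open Scope ring_scope.

Section Polytopes.
Variables (R : realType) (d : nat).
Implicit Types (P F : set 'cV[R]_d) (a x : 'cV[R]_d) (b : R).

Definition dotp a x : R := (a^T *m x) 0 0.

Definition conv_hull m (x : 'I_m -> 'cV[R]_d) : set 'cV[R]_d :=
  [set y | exists c : 'I_m -> R,
     [/\ forall i, 0 <= c i, \sum_i c i = 1 & y = \sum_i c i *: x i]].

Definition polytope P : Prop :=
  exists (m : nat) (x : 'I_m -> 'cV[R]_d), P = conv_hull x.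

Definition affinely_independent m (x : 'I_m -> 'cV[R]_d) : Prop :=
  forall c : 'I_m -> R,
    \sum_i c i = 0 -> \sum_i c i *: x i = 0 -> forall i, c i = 0.

(* The affine hull of P has dimension k: P contains k+1 but not k+2 affinely
   independent points. No k satisfies this when P is empty. *)
Definition has_dim P (k : nat) : Prop :=
  (exists x : 'I_k.+1 -> 'cV[R]_d,
     (forall i, P (x i)) /\ affinely_independent x) /\
  ~ (exists x : 'I_k.+2 -> 'cV[R]_d,
       (forall i, P (x i)) /\ affinely_independent x).

Definition valid_ineq P a b : Prop := forall x, P x -> dotp a x <= b.

Definition face_of P a b : set 'cV[R]_d := P `&` [set x | dotp a x = b].

Definition is_face P F : Prop :=
  exists a b, valid_ineq P a b /\ F = face_of P a b.

Definition is_vertex P x : Prop := is_face P [set x].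

Definition is_facet P F : Prop :=
  is_face P F /\ exists k, has_dim F k /\ has_dim P k.+1.

(* The polygon may lie in a plane of any R^d, and likewise the segment
   (n = 2) in a line of any R^d; the case d = dim P is included. *)
Definition is_ngon (n : nat) P : Prop :=
  [/\ polytope P,
      has_dim P (if n == 2%N then 1%N else 2%N) &
      ([set x | is_vertex P x] #= `I_n)%card].

(* Rows enumerate the facets and columns the vertices, each exactly once, in
   any order and with any choice of facet-defining inequalities. *)
Definition is_slack_matrix P f v (S : 'M[R]_(f, v)) : Prop :=
  exists (a : 'I_f -> 'cV[R]_d) (b : 'I_f -> R) (x : 'I_v -> 'cV[R]_d),
    [/\ forall i, valid_ineq P (a i) (b i),
        set_bij [set: 'I_f] [set F | is_facet P F]
          (fun i => face_of P (a i) (b i)),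
        set_bij [set: 'I_v] [set p | is_vertex P p] x &
        forall i j, S i j = b i - dotp (a i) (x j)].

End Polytopes.

Section RectangleCovers.
Variables (R : realType) (f v : nat) (M : 'M[R]_(f, v)).

Definition is_rectangle (Q : {set 'I_f} * {set 'I_v}) : bool :=
  [forall i in Q.1, forall j in Q.2, 0 < M i j].

Definition is_rectangle_cover (C : {set {set 'I_f} * {set 'I_v}}) : bool :=
  [forall Q in C, is_rectangle Q] &&
  [forall i, forall j,
     (0 < M i j) ==> [exists Q in C, (i \in Q.1) && (j \in Q.2)]].

Definition all_rectangles : {set {set 'I_f} * {set 'I_v}} :=
  [set Q | is_rectangle Q]%SET.

Lemma all_rectangles_cover : is_rectangle_cover all_rectangles.
Proof.
apply/andP; split; first by apply/forall_inP => Q; rewrite inE.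
apply/forallP => i; apply/forallP => j; apply/implyP => Mij.
apply/exists_inP; exists ([set i]%SET, [set j]%SET); last by rewrite !inE !eqxx.
rewrite inE; apply/forall_inP => k; rewrite inE => /eqP ->.
by apply/forall_inP => l; rewrite inE => /eqP ->.
Qed.

(* By all_rectangles_cover the minimum is over a nonempty set of covers. *)
Definition rectangle_covering_number : nat :=
  #|[arg min_(C < all_rectangles | is_rectangle_cover C) #|C|]%N|.

End RectangleCovers.

(* Main.v *)
(** Given a rectangle cover with [r] rectangles, send a vertex to the set of
    rectangles whose columns contain it and an edge to the set of rectangles
    whose rows avoid it.  The set of a vertex lies in the set of an edge exactly
    when the slack entry vanishes, i.e. when they are incident, so the vertex sets
    and the edge sets are two antichains of a Boolean lattice, comparable only
    along the [2n] incidences.  A maximal chain meets at most one vertex set [A] and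
    at most one edge set [C], and both only if these are incident.  Among the
    chains through [A], a fraction at most [1 / (r - |A|)] also goes through [C];
    among those through [C], a fraction at most [1 / |C|] also goes through [A].
    Counting all maximal chains, an incidence then accounts for at least
    [(r - 1) (r - 1)! / (2 'C(r - 1, r %/ 2))] of the [r!] chains, which is the bound
    because [(r - r %/ 2) 'C(r, r %/ 2) = r 'C(r - 1, r %/ 2)].

    The incidences are found in affine coordinates of the plane of the polygon:
    the two vertices of an edge are its extreme points along the edge direction,
    and the two edges at a vertex are those of extreme slope.  A segment is treated
    apart: [r >= 2] suffices there. *)

Require Import Defs.
From mathcomp Require Import all_boot all_order all_algebra.
From mathcomp Require Import boolp classical_sets functions cardinality reals.
From mathcomp Require Import zify ring lra.

Set Implicit Arguments.
Unset Strict Implicit.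
Unset Printing Implicit Defensive.

Import Order.TTheory GRing.Theory Num.Theory.

Local Open Scope set_scope.
Local Open Scope nat_scope.

(** * Factorial and binomial estimates *)

(** Raising [l] by one multiplies the left side by [l + 1] and the right side by [k + l], which is
    no smaller because [k] is positive. *)
Lemma fact_mul_leq k l : 0 < k -> 0 < l -> k`! * l`! <= (k + l).-1`!.
Proof.
move=> k0; elim: l => // -[|l] IH _; first by rewrite muln1 addn1.
rewrite addnS /= [l.+2`!]factS mulnCA addnS factS.
by rewrite leq_mul //; [lia | have := IH isT; rewrite addnS].
Qed.

(** A row of binomials increases up to its middle, and symmetry reflects the upper half. The middle
    is rounded up so that for [m = r - 1] it is [r %/ 2]. *)
Lemma bin_max m k : 'C(m, k) <= 'C(m, m.+1 %/ 2).
Proof.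
have up j : j.*2 < m -> 'C(m, j) <= 'C(m, j.+1).
  move=> jm; rewrite -(leq_pmul2l (ltn0Sn j)) mul_bin_left leq_pmul2r ?bin_gt0; lia.
have lo j d : (j + d).*2 <= m.+1 -> 'C(m, j) <= 'C(m, j + d).
  elim: d => [|d IH] h; first by rewrite addn0.
  by rewrite addnS (leq_trans (IH _)) ?up //; lia.
have low j : j.*2 <= m.+1 -> 'C(m, j) <= 'C(m, m.+1 %/ 2).
  by move=> h; rewrite -(@subnKC j (m.+1 %/ 2)); [apply: lo|]; lia.
have [h|h] := leqP k.*2 m.+1; first exact: low.
have [km|mk] := leqP k m; last by rewrite bin_small.
by rewrite -bin_sub // low //; lia.
Qed.

(** * Maximal chains of subsets *)

Section Chains.
Variable T : finType.
Implicit Types A B : {set T}.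
Local Notation chains := (permutations (enum T)).

(* Maximal chains are encoded as permutations of [T]; the set of cardinality [k] in
   the chain is the set of the first [k] terms. *)
Definition starts_with A (s : seq T) := [set x in take #|A| s]%SET == A.

Lemma starts_with_subset A B s : starts_with A s -> starts_with B s ->
  #|A| <= #|B| -> A \subset B.
Proof.
move=> /eqP eA /eqP eB le; rewrite -eA -eB; apply/fintype.subsetP => x.
by rewrite !inE -(take_takel s le); apply: mem_take.
Qed.

Lemma set_permutation A u : u \in permutations (enum A) ->
  size u = #|A| /\ [set x in u]%SET = A.
Proof.
rewrite mem_permutations => h; rewrite (perm_size h) -cardE; split=> //.
by apply/finset.setP => x; rewrite inE (perm_mem h) mem_enum.
Qed.

Lemma uniq_permutation A u : uniq u -> [set x in u]%SET = A ->
  u \in permutations (enum A).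
Proof.
move=> Uu <-; rewrite mem_permutations uniq_perm ?enum_uniq // => x.
by rewrite mem_enum inE.
Qed.

Lemma chain_cat A s : s \in chains -> starts_with A s ->
  exists u w, [/\ s = u ++ w, u \in permutations (enum A)
    & w \in permutations (enum (~: A))].
Proof.
rewrite mem_permutations => h /eqP eA.
have Us : uniq s by rewrite (perm_uniq h) enum_uniq.
exists (take #|A| s), (drop #|A| s); rewrite cat_take_drop; split=> //.
  by apply: uniq_permutation; rewrite // take_uniq.
move: Us; rewrite -{1}(cat_take_drop #|A| s) cat_uniq => /and3P[_ /hasPn nh Ud].
apply: uniq_permutation => //; apply/finset.setP => x; rewrite !inE -{2}eA inE.
apply/idP/idP => [/nh//|]; apply: contraNT => xd.
have: x \in s by rewrite (perm_mem h) mem_enum.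
by rewrite -{1}(cat_take_drop #|A| s) mem_cat (negPf xd) orbF.
Qed.

(** Distinct pairs of an ordering of [A] and an ordering of its complement concatenate to distinct
    chains through [A]. *)
Lemma count_starts_with A :
  (#|A|)`! * (#|T| - #|A|)`! <= count (starts_with A) chains.
Proof.
pose L := [seq u ++ w | u <- permutations (enum A),
  w <- permutations (enum (~: A))].
have sL : size L = (#|A|)`! * (#|T| - #|A|)`!.
  by rewrite size_allpairs !size_permutations ?enum_uniq // -!cardE [#|~: A|]cardsCs finset.setCK.
rewrite -sL -size_filter; apply: uniq_leq_size.
  apply: allpairs_uniq; rewrite ?permutations_uniq //.
  move=> _ _ /allpairsP[[u w] /= [hu _ ->]] /allpairsP[[u' w'] /= [hu' _ ->]] /= /eqP.
  have [su _] := set_permutation hu; have [su' _] := set_permutation hu'.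
  by rewrite eqseq_cat ?su ?su' // => /andP[/eqP-> /eqP->].
move=> _ /allpairsP[[u w] /= [hu hw ->]].
have [su eu] := set_permutation hu.
rewrite mem_filter /starts_with -su take_size_cat // eu eqxx /=.
rewrite mem_permutations; move: hu hw; rewrite !mem_permutations => hu hw.
apply: uniq_perm; rewrite ?enum_uniq //.
  rewrite cat_uniq (perm_uniq hu) (perm_uniq hw) !enum_uniq andbT.
  apply/hasPn => x; rewrite (perm_mem hw) mem_enum inE => /=.
  by rewrite (perm_mem hu) mem_enum.
by move=> x; rewrite mem_cat (perm_mem hu) (perm_mem hw) !mem_enum !inE orbN.
Qed.

(** A chain through both sets splits into orderings of [A], of [B :\: A] and of the complement of
    [B]. An upper bound is what the overlaps require, since they enter the chain count with the
    opposite sign. *)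
Lemma count_starts_with2 A B : A \subset B ->
  count (fun s => starts_with A s && starts_with B s) chains
    <= (#|A|)`! * (#|B| - #|A|)`! * (#|T| - #|B|)`!.
Proof.
move=> AB; pose L := [seq u ++ w | u <- [seq u ++ w | u <- permutations (enum A),
  w <- permutations (enum (B :\: A))], w <- permutations (enum (~: B))].
have sL : size L = (#|A|)`! * (#|B| - #|A|)`! * (#|T| - #|B|)`!.
  rewrite !size_allpairs !size_permutations ?enum_uniq // -!cardE.
  by rewrite [#|~: B|]cardsCs finset.setCK cardsD (finset.setIidPr AB).
rewrite -sL -size_filter uniq_leq_size ?filter_uniq ?permutations_uniq //.
move=> s; rewrite mem_filter => /andP[/andP[sA sB] hs].
have [u [w [es hu hw]]] := chain_cat hs sB.
rewrite es; apply: allpairs_f => //.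
have [su eu] := set_permutation hu.
have lAB : #|A| <= #|B| by apply: subset_leq_card.
have Uu : uniq u by rewrite (perm_uniq (_ : perm_eq _ (enum B))) ?enum_uniq -?mem_permutations.
move: sA; rewrite /starts_with es takel_cat ?su // => /eqP eA.
rewrite -(cat_take_drop #|A| u); apply: allpairs_f.
  by apply: uniq_permutation; rewrite // take_uniq.
move: Uu; rewrite -{1}(cat_take_drop #|A| u) cat_uniq => /and3P[_ /hasPn nh Ud].
apply: uniq_permutation => //; apply/finset.setP => x; rewrite !inE -eu -{2}eA !inE.
apply/idP/andP => [xd|[xt]]; first by rewrite nh // (mem_drop xd).
by rewrite -{1}(cat_take_drop #|A| u) mem_cat (negPf xt).
Qed.

End Chains.

(** * Counting chains through two antichains with polygonal incidences *)

Lemma count_sum (I : Type) (a : pred I) (s : seq I) : count a s = \sum_(x <- s) a x.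
Proof. by rewrite -sum1_count big_mkcond; apply: eq_bigr => x _; case: (a x). Qed.

Lemma sum_bool_le1 (I : finType) (a : pred I) :
  (forall i k, a i -> a k -> i = k) -> \sum_i a i <= 1.
Proof.
move=> h; have -> : \sum_i a i = #|a|.
  by rewrite -sum1_card [RHS]big_mkcond; apply: eq_bigr => i _; rewrite unfold_in;
    case: (a i).
by apply/card_le1_eqP => i k ai ak; apply: h.
Qed.

Lemma card2_pair (I : finType) (a : pred I) : #|[set i | a i]%SET| = 2 ->
  exists i k, [/\ i != k, a i & a k].
Proof.
move=> h; have /card_gt1P : 1 < #|[set i | a i]%SET| by rewrite h.
by case=> i [k [hi hk ne]]; exists i, k; rewrite !inE in hi hk.
Qed.

Section Incidence.
Variables (V F T : finType) (inc : F -> V -> bool).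
Variables (A : V -> {set T}) (C : F -> {set T}).
Hypothesis incE : forall j i, (A j \subset C i) = inc i j.
Hypothesis card_facet : forall i, #|[set j | inc i j]%SET| = 2.
Hypothesis card_vertex : forall j, #|[set i | inc i j]%SET| = 2.
Hypothesis inc_inj : forall i k j l, j != l ->
  inc i j -> inc i l -> inc k j -> inc k l -> i = k.
Hypothesis card_V : 2 < #|V|.
Local Notation r := #|T|.

(** Both facets at [k] also contain [j], and distinct facets cannot share two vertices. *)
Lemma vertex_antichain j k : A j \subset A k -> j = k.
Proof.
move=> jk; apply/eqP; case: eqVneq => // ne.
have [i1 [i2 [/eqP ni h1 h2]]] := card2_pair (card_vertex k).
have up i : inc i k -> inc i j by rewrite -!incE; apply: fintype.subset_trans.
by case: ni; apply: inc_inj ne _ _ _ _ => //; apply: up.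
Qed.

Lemma facet_antichain i k : C i \subset C k -> i = k.
Proof.
move=> ik; have [j [l [ne h1 h2]]] := card2_pair (card_facet i).
have up v : inc i v -> inc k v by rewrite -!incE => /fintype.subset_trans; apply.
by apply: inc_inj ne _ _ _ _ => //; apply: up.
Qed.

(** Both vertex sets below [C i] would lie in [A j], so both vertices of [i] would equal [j]. *)
Lemma facet_notin_vertex i j : ~~ (C i \subset A j).
Proof.
apply/negP => ij; have [k [l [/eqP ne]]] := card2_pair (card_facet i).
rewrite -!incE => h1 h2; apply: ne; transitivity j.
  by apply: vertex_antichain; apply: fintype.subset_trans ij.
by apply/esym/vertex_antichain; apply: fintype.subset_trans ij.
Qed.

Lemma card_vertex_set_gt0 j : 0 < #|A j|.
Proof.
rewrite lt0n cards_eq0; apply/eqP => A0.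
have [k nk] : exists k, k != j.
  apply/existsP; rewrite -negb_forall; apply/negP => /forallP h.
  suff : #|V| <= 1 by lia.
  by apply/card_le1_eqP => x y _ _; rewrite (eqP (h x)) (eqP (h y)).
by case/eqP: nk; apply/esym/vertex_antichain; rewrite A0 finset.sub0set.
Qed.

(** A full [C i] would make every vertex incident to [i], leaving only two vertices. *)
Lemma card_facet_set_lt i : #|C i| < r.
Proof.
rewrite ltn_neqAle max_card andbT; apply/negP => /eqP full.
have CT : C i = [set: T]%SET by apply/eqP; rewrite eqEcard finset.subsetT cardsT full /=.
suff : #|V| = 2 by lia.
by rewrite -(card_facet i) -cardsT; congr #|pred_of_set _|; apply/finset.setP => j;
  rewrite !inE -incE CT finset.subsetT.
Qed.

Lemma card_flag i j : inc i j -> #|A j| < #|C i|.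
Proof.
rewrite -incE => h; rewrite ltn_neqAle subset_leq_card // andbT.
apply/negP => /eqP e; case/negP: (facet_notin_vertex i j).
by have /eqP -> : A j == C i by rewrite eqEcard h e /=.
Qed.

Lemma card_ground_gt2 : 2 < r.
Proof.
have /card_gt0P[j _] : 0 < #|V| by lia.
have [i [_ [_ ij _]]] := card2_pair (card_vertex j).
have := card_vertex_set_gt0 j; have := card_flag ij; have := card_facet_set_lt i; lia.
Qed.

(** Each antichain contributes at most one set to the chain. When both contribute, the two sets are
    comparable, hence incident, and the correction term is positive. *)
Lemma chain_inequality (s : seq T) :
  \sum_j starts_with (A j) s + \sum_i starts_with (C i) s <=
  1 + \sum_j \sum_(i | inc i j) (starts_with (A j) s && starts_with (C i) s).
Proof.
have le1 (I : finType) (D : I -> {set T}) :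
    (forall i k, D i \subset D k -> i = k) -> \sum_i starts_with (D i) s <= 1.
  move=> anti; apply: sum_bool_le1 => i k hi hk.
  case: (leqP #|D i| #|D k|) => [le|/ltnW le].
    by apply: anti; apply: (starts_with_subset hi hk le).
  by apply/esym/anti; apply: (starts_with_subset hk hi le).
have := le1 _ _ vertex_antichain; have := le1 _ _ facet_antichain.
case: (posnP (\sum_i starts_with (C i) s)) => [->|C0 C1 A1]; first lia.
case: (posnP (\sum_j starts_with (A j) s)) => [->|A0]; first lia.
move: C0 A0; rewrite !lt0n !sum_nat_eq0 !negb_forall => /existsP[i] hi /existsP[j] hj.
move: hi hj; rewrite !eqb0 !negbK => hi hj.
have ij : inc i j.
  rewrite -incE; case: (leqP #|A j| #|C i|) => [le|/ltnW le].
    exact: (starts_with_subset hj hi le).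
  by case/negP: (facet_notin_vertex i j); apply: (starts_with_subset hi hj le).
have : 0 < \sum_j \sum_(i | inc i j) (starts_with (A j) s && starts_with (C i) s).
  by rewrite (bigD1 j) //= (bigD1 i) //= hi hj.
lia.
Qed.

Lemma sum_chains :
  \sum_j ((#|A j|)`! * (r - #|A j|)`!) + \sum_i ((#|C i|)`! * (r - #|C i|)`!) <=
  r`! + \sum_j \sum_(i | inc i j)
    (#|A j|)`! * (#|C i| - #|A j|)`! * (r - #|C i|)`!.
Proof.
pose chains := permutations (enum T).
apply: (@leq_trans (\sum_(s <- chains)
    (\sum_j starts_with (A j) s + \sum_i starts_with (C i) s))).
  rewrite big_split /=; apply: leq_add; rewrite exchange_big; apply: leq_sum => i _;
  by rewrite -count_sum count_starts_with.
apply: (@leq_trans (\sum_(s <- chains) (1 +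
   \sum_j \sum_(i | inc i j) (starts_with (A j) s && starts_with (C i) s)))).
  by apply: leq_sum => s _; apply: chain_inequality.
rewrite big_split /= sum1_size size_permutations ?enum_uniq // -cardE leq_add2l.
rewrite exchange_big; apply: leq_sum => j _; rewrite exchange_big; apply: leq_sum => i ij.
by rewrite -(count_sum (fun s => _ && _)) count_starts_with2 // incE.
Qed.

Lemma sum_flags_vertex (f : V -> nat) : \sum_j \sum_(i | inc i j) f j = 2 * \sum_j f j.
Proof.
rewrite big_distrr; apply: eq_bigr => j _.
by rewrite sum_nat_const -(card_vertex j) cardsE.
Qed.

Lemma sum_flags_facet (f : F -> nat) : \sum_j \sum_(i | inc i j) f i = 2 * \sum_i f i.
Proof.
rewrite big_distrr (exchange_big_dep predT) //=; apply: eq_bigr => i _.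
by rewrite sum_nat_const -(card_facet i) cardsE.
Qed.

(** The overlap has coefficient 2 because a sum over flags counts each vertex term and each facet
    term twice, but each overlap once. *)
Lemma flag_weight i j : inc i j ->
  r.-1 * (r.-1)`! + 2 * 'C(r.-1, r %/ 2) * ((#|A j|)`! * (#|C i| - #|A j|)`! * (r - #|C i|)`!)
  <= 'C(r.-1, r %/ 2) * ((#|A j|)`! * (r - #|A j|)`! + (#|C i|)`! * (r - #|C i|)`!).
Proof.
move=> ij; have := card_flag ij; have := card_facet_set_lt i; have :=
  card_vertex_set_gt0 j.
move: #|A j| #|C i| => a c a0 cr ac.
have -> : r %/ 2 = r.-1.+1 %/ 2 by congr (_ %/ _); lia.
set M := 'C(_, _).
have binM k : k <= r.-1 -> (r.-1)`! <= M * (k`! * (r.-1 - k)`!).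
  by move=> kr; rewrite -(bin_fact kr) leq_mul2r bin_max orbT.
(* The overlap is bounded in two ways, by merging the last two factorials or the first two; each
   bound is the reciprocal of a binomial of row [r - 1], up to [(r - 1)!]. *)
have up : a`! * (c - a)`! * (r - c)`! <= a`! * (r.-1 - a)`!.
  rewrite -mulnA leq_mul2l; apply/orP; right.
  by apply: leq_trans (fact_mul_leq _ _) _; [lia|lia|apply/eq_leq; congr _`!; lia].
have dn : a`! * (c - a)`! * (r - c)`! <= c.-1`! * (r.-1 - c.-1)`!.
  have -> : r.-1 - c.-1 = r - c by lia.
  rewrite leq_mul2r; apply/orP; right.
  by apply: leq_trans (fact_mul_leq _ _) _; [lia|lia|apply/eq_leq; congr _`!; lia].
have {}up := leq_mul (leqnn M) up; have {}dn := leq_mul (leqnn M) dn.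
have eA : a`! * (r - a)`! = (r - a) * (a`! * (r.-1 - a)`!).
  by have -> : r - a = (r.-1 - a).+1 by [lia]; rewrite factS mulnCA.
have eC : c`! * (r - c)`! = c * (c.-1`! * (r.-1 - c.-1)`!).
  have -> : r.-1 - c.-1 = r - c by lia.
  by case: (c) ac => // c' _; rewrite factS mulnA.
rewrite eA eC mulnDr (mulnCA M (r - a)) (mulnCA M c) -[2 * M * _]mulnA.
move: up dn (binM a) (binM c.-1); set X := M * _; set U := M * _; set W := M * _.
move=> XU XW LU LW; have {}LU := LU ltac:(lia); have {}LW := LW ltac:(lia).
(* The overlap [2 X] is charged evenly to [U] and [W]. *)
apply: (@leq_trans ((r - a).-1 * U + c.-1 * W + U + W)); last by nia.
(* As [a < c], the remaining multiplicities [r - a - 1] and [c - 1] of [U] and [W] add up to at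
   least [r - 1]. *)
have h1 := leq_mul (leqnn (r - a).-1) LU; have h2 := leq_mul (leqnn c.-1) LW.
have h3 : r.-1 * (r.-1)`! <= ((r - a).-1 + c.-1) * (r.-1)`!.
  by rewrite leq_mul2r; apply/orP; right; lia.
by rewrite mulnDl in h3; lia.
Qed.

(** Summing [flag_weight] over all flags and inserting [sum_chains] times [2 * M] cancels the
    overlaps. What remains is the bound multiplied by [2 * (r - 1)!]. *)
Theorem card_vertices_leq : #|V| * r.-1 <= r * 'C(r.-1, r %/ 2).
Proof.
have r0 : 0 < r by have := card_ground_gt2; lia.
set M := 'C(_, _).
have flags : \sum_j \sum_(i | inc i j) (r.-1 * (r.-1)`! + 2 * M *
      ((#|A j|)`! * (#|C i| - #|A j|)`! * (r - #|C i|)`!)) <=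
    \sum_j \sum_(i | inc i j) M * ((#|A j|)`! * (r - #|A j|)`! + (#|C i|)`! * (r - #|C i|)`!).
  by apply: leq_sum => j _; apply: leq_sum => i ij; apply: flag_weight.
have split2 (f g : V -> F -> nat) : \sum_j \sum_(i | inc i j) (f j i + g j i) =
    \sum_j \sum_(i | inc i j) f j i + \sum_j \sum_(i | inc i j) g j i.
  by rewrite -big_split; apply: eq_bigr => j _; rewrite big_split.
have distr k (f : V -> F -> nat) : \sum_j \sum_(i | inc i j) k * f j i =
    k * \sum_j \sum_(i | inc i j) f j i.
  by rewrite big_distrr; apply: eq_bigr => j _; rewrite big_distrr.
move: flags; rewrite split2 !distr split2 sum_flags_vertex sum_flags_vertex sum_flags_facet.
rewrite sum_nat_const -mulnDr (_ : #|(fun=> true) : pred V| = #|V|);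
  last by apply: eq_card.
have := leq_mul (leqnn (2 * M)) sum_chains.
rewrite (_ : r`! = r * (r.-1)`!); last by case: (r) r0 => // r' _; rewrite factS.
move: (\sum_j \sum_(i | _) _) (\sum_j _ + \sum_i _) => X Y.
have L0 := fact_gt0 r.-1; move: (r.-1)`! L0 => L L0 h1 h2.
rewrite -(leq_pmul2r L0) -(leq_pmul2l (ltn0Sn 1)).
by move: #|V| #|T| r.-1 (M) h1 h2 => a b c m h1 h2; nia.
Qed.
End Incidence.

Local Open Scope classical_set_scope.
Local Open Scope ring_scope.

(** * Planar polytopes *)

Section AffineGeometry.
Variables (R : realType) (d : nat).
Implicit Types (P F : set 'cV[R]_d) (a x y u w : 'cV[R]_d).

Lemma dotpD a x y : dotp a (x + y) = dotp a x + dotp a y.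
Proof. by rewrite /dotp mulmxDr mxE. Qed.

Lemma dotpZ a k x : dotp a (k *: x) = k * dotp a x.
Proof. by rewrite /dotp -scalemxAr mxE. Qed.

Lemma dotpB a x y : dotp a (x - y) = dotp a x - dotp a y.
Proof. by rewrite -scaleN1r dotpD dotpZ mulN1r. Qed.

Lemma dotpDl a b x : dotp (a + b) x = dotp a x + dotp b x.
Proof. by rewrite /dotp linearD mulmxDl mxE. Qed.

Lemma dotpZl k a x : dotp (k *: a) x = k * dotp a x.
Proof. by rewrite /dotp linearZ -scalemxAl mxE. Qed.

Lemma dotp_sum a m (c : 'I_m -> R) (x : 'I_m -> 'cV[R]_d) :
  dotp a (\sum_i c i *: x i) = \sum_i c i * dotp a (x i).
Proof.
rewrite /dotp mulmx_sumr summxE; apply: eq_bigr => i _.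
by rewrite -scalemxAr mxE.
Qed.

Lemma affinely_independent2 (p q : 'cV[R]_d) : p != q ->
  affinely_independent (fun i : 'I_2 => [:: p; q]`_i).
Proof.
move=> pq c; rewrite !big_ord_recl !big_ord0 /= !addr0 => /eqP.
rewrite addrC addr_eq0 => /eqP c1; rewrite c1 scaleNr -scalerBr => /eqP.
rewrite scaler_eq0 subr_eq0 (negPf pq) orbF => /eqP c0 i.
case: (unliftP ord0 i) => [j|] -> //; rewrite (ord1 j) c1 c0 oppr0 //.
Qed.

Lemma affinely_independent3 (x : 'I_3 -> 'cV[R]_d) (c0 c1 c2 : R) :
  affinely_independent x -> c0 + c1 + c2 = 0 ->
  c0 *: x 0 + c1 *: x 1 + c2 *: x 2%:R = 0 -> [/\ c0 = 0, c1 = 0 & c2 = 0].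
Proof.
move=> ind s0 v0; pose c (i : 'I_3) := [:: c0; c1; c2]`_i.
have h : forall i, c i = 0.
  have l1 : lift ord0 ord0 = 1 :> 'I_3 by apply: val_inj.
  have l2 : lift ord0 (lift ord0 ord0) = 2%:R :> 'I_3 by apply: val_inj.
  by apply: ind; rewrite !big_ord_recl !big_ord0 /c /= addr0 addrA ?l1 ?l2.
by split; [have := h 0 | have := h 1 | have := h 2%:R].
Qed.

Lemma affinely_independent_restrict m k (km : (k <= m)%N) (x : 'I_m -> 'cV[R]_d) :
  affinely_independent x -> affinely_independent (fun i => x (widen_ord km i)).
Proof.
move=> ind c c0 v0 i.
(* [e] extends [c] by zero. The sum of the coefficients is treated as a combination of ones in
   [R^o], so that [sumE] serves both conditions. *)
pose e (j : 'I_m) : R := if insub (val j) is Some i' then c i' else 0.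
have eW i' : e (widen_ord km i') = c i'.
  by rewrite /e; case: insubP => [j _ /val_inj -> //|]; rewrite /= ltn_ord.
have sumE (V : lmodType R) (f : 'I_m -> V) :
    \sum_j e j *: f j = \sum_i' c i' *: f (widen_ord km i').
  rewrite (bigID (fun j : 'I_m => (j < k)%N)) /= addrC big1 ?add0r => [|j jk].
    rewrite (big_ord_narrow km).
    by apply: eq_bigr => i' _; rewrite eW.
  by rewrite /e insubN // scale0r.
rewrite -eW; apply: ind; last by rewrite sumE.
transitivity (\sum_j e j *: (1 : R^o)); first by apply: eq_bigr => j _;
  rewrite /GRing.scale /= mulr1.
rewrite sumE -[RHS]c0; by apply: eq_bigr => j _; rewrite /GRing.scale /= mulr1.
Qed.

Lemma has_dim_inj P k l : has_dim P k -> has_dim P l -> k = l.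
Proof.
wlog kl : k l / (k < l)%N => [h|].
  have [kl|lk|//] := ltngtP k l; first exact: h.
  by move=> hk hl; rewrite (h l k).
move=> [_ nk] [[x [xP ind]] _]; case: nk.
have kl' : (k.+2 <= l.+1)%N by lia.
by exists (fun i => x (widen_ord kl' i)); split=> //;
  apply: affinely_independent_restrict.
Qed.

(* The last clause says that [P] is not contained in a line: no nontrivial
   functional of the coordinates is constant on [P]. *)
Lemma has_dim2_coords P : has_dim P 2 -> exists o e1 e2 u w,
  (forall y, P y -> y = o + dotp u y *: e1 + dotp w y *: e2) /\
  (forall a b c : R, (forall y, P y -> a * dotp u y + b * dotp w y = c) ->
     a = 0 /\ b = 0).
Proof.
move=> [[x [xP ind]] dep].
pose e1 := x 1 - x 0; pose e2 := x 2%:R - x 0.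
pose E : 'M[R]_(2, d) := \matrix_(i, j) (if i == 0 then e1 j 0 else e2 j 0).
have rE : row_free E.
  apply: inj_row_free => v vE.
  have vE' : v 0 0 *: e1 + v 0 1 *: e2 = 0.
    apply/matrixP => j k; rewrite (ord1 k).
    have := congr1 (fun M : 'rV_d => M 0 j) vE; rewrite !mxE => <-.
    by rewrite !big_ord_recl big_ord0 addr0 !mxE; congr (v _ _ * _ + v _ _ * _);
      apply: val_inj.
  have [||_ v1 v2] := @affinely_independent3 x (- v 0 0 - v 0 1) (v 0 0) (v 0 1) ind.
  - ring.
  - by rewrite -[RHS]vE'; apply/colP => k; rewrite !mxE; ring.
  apply/rowP => i; rewrite mxE; case: (unliftP 0 i) => [j|] ->; last by rewrite v1.
  by apply: etrans v2; rewrite (ord1 j); congr (v _ _); apply: val_inj.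
(* The columns of a right inverse of [E] are functionals dual to [e1] and [e2]. *)
pose B := pinvmx E.
have EB := mulmxVp rE.
pose u := col 0 B; pose w := col 1 B.
have dB (k : 'I_2) y : dotp (col k B) y = \sum_j y j 0 * B j k.
  by rewrite /dotp mxE; apply: eq_bigr => j _; rewrite !mxE mulrC.
have dE (i k : 'I_2) : \sum_j E i j * B j k = (i == k)%:R.
  by have := congr1 (fun M : 'M_2 => M i k) EB; rewrite !mxE.
have d1 k : dotp (col k B) e1 = (0 == k)%:R.
  by rewrite dB -dE; apply: eq_bigr => j _; rewrite [E _ _]mxE.
have d2 k : dotp (col k B) e2 = (1 == k)%:R.
  by rewrite dB -dE; apply: eq_bigr => j _; rewrite [E _ _]mxE.
(* The origin is [x 0] shifted back by its own coordinates, so that [u] and [w] themselves, not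
   differences, are the coordinates. *)
exists (x 0 - dotp u (x 0) *: e1 - dotp w (x 0) *: e2), e1, e2, u, w; split; last first.
  move=> a b c h; have := h _ (xP 0); have := h _ (xP 1); have := h _ (xP 2%:R).
  have := d1 0; have := d1 1; have := d2 0; have := d2 1.
  rewrite -/u -/w /e1 /e2 !dotpB /=.
  by move=> ? ? ? ? ? ? ?; split; nra.
move=> y Py.
(* The four points are affinely dependent, and independence of the first three forces a nonzero
   coefficient on [y]. *)
have [k0 [k1 [k2 [k3 [s0 v0 n3]]]]] : exists k0 k1 k2 k3, [/\ k0 + k1 + k2 + k3 = 0,
    k0 *: x 0 + k1 *: x 1 + k2 *: x 2%:R + k3 *: y = 0 & k3 != 0].
  apply: contrapT => nc; apply: dep; exists (fun i => [:: x 0; x 1; x 2%:R; y]`_i).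
  split; first by case=> [] [|[|[|[|//]]]] ? /=.
  move=> c; rewrite !big_ord_recl !big_ord0 /= !addr0 !addrA => c0 v0.
  have z3 : c (lift ord0 (lift ord0 (lift ord0 ord0))) = 0.
    apply/eqP/negPn/negP => n3; apply: nc.
    by do 4!eexists; split; [exact: c0 | exact: v0 | exact: n3].
  rewrite z3 scale0r !addr0 in c0 v0.
  have [z0 z1 z2] := affinely_independent3 ind c0 v0.
  case=> [] [|[|[|[|//]]]] p; [apply: etrans z0|apply: etrans z1|apply: etrans z2|
    apply: etrans z3]; by congr (c _); apply: val_inj.
have ye : y - x 0 = (- k1 / k3) *: e1 + (- k2 / k3) *: e2.
  apply/colP => j; have := congr1 (fun M : 'cV_d => M j 0) v0; rewrite !mxE.
  have -> : k0 = - k1 - k2 - k3 by move: s0; lra.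
  move=> vj; apply: (mulfI n3).
  by rewrite [RHS]mulrDr !mulrA ![k3 * _ / k3]mulrAC divff // !mul1r; lra.
move/eqP: ye; rewrite subr_eq => /eqP ->.
clearbody e1 e2; rewrite !(dotpD, dotpZ) /u /w !d1 !d2 /=.
by apply/colP => j; rewrite !mxE; ring.
Qed.

Lemma vertex_mem P p : is_vertex P p -> P p.
Proof. by case=> f [g [_ e]]; have : [set p] p by []; rewrite e => -[]. Qed.

End AffineGeometry.

(** * Convex hulls and supporting functionals *)

Section ConvexHull.
Variables (R : realType) (d m : nat) (x : 'I_m -> 'cV[R]_d).
Implicit Types (a y p : 'cV[R]_d) (b : R).

Lemma conv_hull_mem i : conv_hull x (x i).
Proof.
exists (fun j => (j == i)%:R); split=> [j||]; first by rewrite ler0n.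
  by rewrite (bigD1 i) //= eqxx big1 ?addr0 // => j /negPf ->.
by rewrite (bigD1 i) //= eqxx scale1r big1 ?addr0 // => j /negPf ->; rewrite scale0r.
Qed.

Lemma conv_hull_valid a b : (forall i, dotp a (x i) <= b) ->
  valid_ineq (conv_hull x) a b.
Proof.
move=> h _ [c [c0 c1 ->]]; rewrite dotp_sum -[b]mul1r -c1 mulr_suml.
by apply: ler_sum => i _; apply: ler_wpM2l.
Qed.

(** The nonnegative terms [c j * (b - dotp a (x j))] sum to zero, so each of them vanishes. *)
Lemma conv_hull_support a b (c : 'I_m -> R) i :
  (forall j, dotp a (x j) <= b) -> (forall j, 0 <= c j) -> \sum_j c j = 1 ->
  dotp a (\sum_j c j *: x j) = b -> c i != 0 -> dotp a (x i) = b.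
Proof.
move=> h c0 c1; rewrite dotp_sum => e ci.
have /psumr_eq0P z : forall j, true -> 0 <= c j * (b - dotp a (x j)).
  by move=> j _; rewrite mulr_ge0 // subr_ge0.
have : c i * (b - dotp a (x i)) = 0.
  apply: z => //; under eq_bigr => j _ do rewrite mulrBr.
  by rewrite sumrB e -mulr_suml c1 mul1r subrr.
by move/eqP; rewrite mulf_eq0 (negPf ci) subr_eq0 => /eqP.
Qed.

Lemma conv_hull_face a b y p :
  (forall i, dotp a (x i) <= b) -> conv_hull x y -> dotp a y = b -> y != p ->
  exists i, x i != p /\ dotp a (x i) = b.
Proof.
move=> h [c [c0 c1 ->]] e yp; apply: contrapT => n.
case/eqP: yp; rewrite -[p]scale1r -c1 scaler_suml; apply: eq_bigr => i _.
have [->|ci] := eqVneq (c i) 0; first by rewrite !scale0r.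
congr (_ *: _); apply/eqP/negPn/negP => xp; apply: n; exists i; split=> //.
exact: conv_hull_support ci.
Qed.

End ConvexHull.

(** * Linear equations in the plane and small perturbations *)

(** The system has determinant [a ^+ 2 + b ^+ 2]. Its two left sides are the coordinates across and
    along a line with normal [(a, b)]. *)
Lemma rotation_eq0 (R : realType) (a b x y : R) : (a != 0) || (b != 0) ->
  a * x + b * y = 0 -> - b * x + a * y = 0 -> x = 0 /\ y = 0.
Proof.
move=> ab h1 h2.
have N0 : a ^+ 2 + b ^+ 2 != 0.
  by rewrite paddr_eq0 ?sqr_ge0 // !sqrf_eq0 negb_and.
split; apply: (mulfI N0); rewrite mulr0.
  by transitivity (a * (a * x + b * y) - b * (- b * x + a * y)); [ring | rewrite h1 h2;
    ring].
by transitivity (b * (a * x + b * y) + a * (- b * x + a * y)); [ring | rewrite h1 h2;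
  ring].
Qed.

Lemma parallel_det (R : realType) (a b a' b' x y : R) : (x != 0) || (y != 0) ->
  a * x + b * y = 0 -> a' * x + b' * y = 0 -> a * b' = a' * b.
Proof.
move=> xy h1 h2; apply/eqP; rewrite -subr_eq0; apply/eqP.
case/orP: xy => n; apply: (mulIf n); rewrite mul0r.
  by transitivity (b' * (a * x + b * y) - b * (a' * x + b' * y));
    [ring | rewrite h1 h2; ring].
by transitivity (a * (a' * x + b' * y) - a' * (a * x + b * y)); [ring | rewrite h1 h2;
  ring].
Qed.

Lemma parallel_eq0 (R : realType) (a b a' b' x y : R) : (a != 0) || (b != 0) ->
  a * b' = a' * b -> a * x + b * y = 0 -> a' * x + b' * y = 0.
Proof.
move=> ab e h; case/orP: ab => n; apply: (mulfI n); rewrite mulr0.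
  transitivity (a' * (a * x + b * y) + (a * b' - a' * b) * y); first ring.
  by rewrite h e; ring.
transitivity (b' * (a * x + b * y) - (a * b' - a' * b) * x); first ring.
by rewrite h e; ring.
Qed.

(** This allows a supporting functional to be tilted while finitely many strict inequalities
    survive. *)
Lemma small_eps (R : realType) (I : finType) (Q : pred I) (A B : I -> R) :
  (forall i, Q i -> 0 < A i) ->
  exists2 e : R, 0 < e & forall i, Q i -> e * B i < A i.
Proof.
move=> A0; pose S := \sum_(i | Q i) `|B i| / A i.
have S0 : 0 <= S by apply: sumr_ge0 => i Qi; rewrite divr_ge0 // ltW ?A0.
have S1 : 0 < 1 + S by rewrite ltr_pwDl.
exists (1 + S)^-1 => [|i Qi]; first by rewrite invr_gt0.
rewrite mulrC ltr_pdivrMr // mulrC -ltr_pdivrMr ?A0 //.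
apply: (@le_lt_trans _ _ S); last by rewrite ltrDr.
rewrite /S (bigD1 i) //=; apply: (@le_trans _ _ (`|B i| / A i)).
  by rewrite ler_pM2r ?invr_gt0 ?A0 // ler_norm.
by rewrite lerDl sumr_ge0 // => j /andP[Qj _]; rewrite divr_ge0 // ltW ?A0.
Qed.

(** * Vertices and edges of a polygon in affine coordinates *)

Section Polygon.
Variables (R : realType) (d m : nat) (x : 'I_m -> 'cV[R]_d) (o e1 e2 u w : 'cV[R]_d).
Local Notation P := (conv_hull x).
Local Notation s y := (dotp u y).
Local Notation t y := (dotp w y).
Hypothesis dimP : has_dim P 2.
Hypothesis coords : forall y, P y -> y = o + s y *: e1 + t y *: e2.
Hypothesis spread : forall a b c : R,
  (forall y, P y -> a * s y + b * t y = c) -> a = 0 /\ b = 0.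
Implicit Types (F G : set 'cV[R]_d) (p q y z : 'cV[R]_d) (a b c : R).

Lemma spread_gen a b c : (forall i, a * s (x i) + b * t (x i) = c) -> a = 0 /\ b = 0.
Proof.
move=> h; apply: (@spread a b c) => _ [k [_ k1 ->]].
rewrite !dotp_sum !mulr_sumr -big_split /= -[c]mul1r -k1 mulr_suml.
by apply: eq_bigr => i _; rewrite -(h i); ring.
Qed.

Lemma dotp_comb a b y : dotp (a *: u + b *: w) y = a * s y + b * t y.
Proof. by rewrite dotpDl !dotpZl. Qed.

Lemma coords_inj y z : P y -> P z -> s y = s z -> t y = t z -> y = z.
Proof. by move=> Py Pz es et; rewrite (coords Py) (coords Pz) es et. Qed.

Lemma functional_coords (f : 'cV[R]_d) : exists a b c,
  forall y, P y -> dotp f y = a * s y + b * t y + c.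
Proof.
exists (dotp f e1), (dotp f e2), (dotp f o) => y Py.
by rewrite {1}(coords Py) !dotpD !dotpZ; ring.
Qed.

(** Faces are described by [s] and [t] alone, since every functional restricts to [P] as an affine
    function of these coordinates. *)
Definition exposed_by F a b c :=
  (forall y, P y -> a * s y + b * t y <= c) /\
  F = [set y | P y /\ a * s y + b * t y = c].

Lemma is_faceP F : is_face P F <-> exists a b c, exposed_by F a b c.
Proof.
split=> [[f [g [fg ->]]]|[a [b [c [le ->]]]]]; last first.
  exists (a *: u + b *: w), c; split=> [y Py|]; first by rewrite dotp_comb le.
  by apply/seteqP; split=> y [Py] /=; rewrite ?dotp_comb; split=> //=; rewrite dotp_comb.
have [a [b [c h]]] := functional_coords f; exists a, b, (g - c); split=> [y Py|].
  by rewrite lerBrDr -h // fg.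
apply/seteqP; split=> y [Py] /= e; split=> //=; first by rewrite -e h // addrK.
by rewrite h // e subrK.
Qed.

Lemma exposed_gen F a b c : (forall i, a * s (x i) + b * t (x i) <= c) ->
  F = [set y | P y /\ a * s y + b * t y = c] -> exposed_by F a b c.
Proof.
move=> h ->; split=> // y Py; rewrite -dotp_comb.
by apply: conv_hull_valid Py => i; rewrite dotp_comb.
Qed.

(** A zero functional would expose all of [P], of the wrong dimension. Conversely, a line contains
    no three affinely independent points, so two points give dimension one. *)
Lemma is_facetP F : is_facet P F <-> exists a b c,
  [/\ (a != 0) || (b != 0), exposed_by F a b c & exists y z, [/\ F y, F z & y != z]].
Proof.
split=> [[/is_faceP[a [b [c eF]]] [k [dF dP]]]|[a [b [c [ab eF [y [z [Fy Fz yz]]]]]]]].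
  have k1 : k = 1%N by have := has_dim_inj dP dimP; lia.
  subst k; exists a, b, c.
  have [y [Fy ind]] := dF.1.
  have yz : y 0 != y 1.
    apply/eqP => e; suff : (1 : R) = 0 by move/eqP; rewrite oner_eq0.
    apply: (ind (fun i => if i == 0 then 1 else -1) _ _ 0).
      by rewrite !big_ord_recl big_ord0 /= addr0 subrr.
    rewrite !big_ord_recl big_ord0 /= addr0 (_ : lift _ _ = 1) ?e; last exact: val_inj.
    by rewrite scale1r scaleN1r subrr.
  split=> //; last by exists (y 0), (y 1).
  rewrite -negb_and; apply/negP => /andP[/eqP a0 /eqP b0].
  have [_ FE] := eF; have := Fy 0; rewrite FE /= a0 b0 !mul0r addr0 => -[_ c0].
  suff FP : F = P by have := has_dim_inj dimP (eq_ind F (fun Q => has_dim Q 1) dF _ FP).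
  rewrite FE a0 b0 -c0; apply/seteqP; split=> v /=; first by case.
  by split=> //; rewrite !mul0r addr0.
split; first by apply/is_faceP; exists a, b, c.
exists 1%N; split=> //; split.
  exists (fun i : 'I_2 => [:: y; z]`_i); split; last exact: affinely_independent2.
  by case=> [] [|[|//]].
move=> [v [Fv ind]]; have [_ FE] := eF.
have Pv i : P (v i) by have := Fv i; rewrite FE => -[].
have ev i : a * s (v i) + b * t (v i) = c by have := Fv i; rewrite FE => -[].
(* [r] is the coordinate along the line. Its cyclic differences are the coefficients of an affine
   dependence between three collinear points; independence makes them vanish, which forces
   [v 0 = v 1]. *)
pose r i := - b * s (v i) + a * t (v i).
have [r12 r20 r01] : [/\ r 1 - r 2%:R = 0, r 2%:R - r 0 = 0 & r 0 - r 1 = 0].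
  apply: (affinely_independent3 ind); first ring.
  pose S (f : 'cV[R]_d -> R) := (r 1 - r 2%:R) * f (v 0) + (r 2%:R - r 0) * f (v 1) +
    (r 0 - r 1) * f (v 2%:R).
  have [S1 S2] : S (dotp u) = 0 /\ S (dotp w) = 0.
    apply: (rotation_eq0 ab).
      transitivity ((r 1 - r 2%:R) * (a * s (v 0) + b * t (v 0)) +
        (r 2%:R - r 0) * (a * s (v 1) + b * t (v 1)) +
        (r 0 - r 1) * (a * s (v 2%:R) + b * t (v 2%:R))); first by rewrite /S; ring.
      by rewrite !ev; ring.
    by rewrite /S /r; ring.
  rewrite {1}(coords (Pv 0)) {1}(coords (Pv 1)) {1}(coords (Pv 2%:R)).
  transitivity (S (dotp u) *: e1 + S (dotp w) *: e2);
    last by rewrite S1 S2 !scale0r addr0.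
  by rewrite /S; apply/colP => j; rewrite !mxE; ring.
have [ds dt] : s (v 0) - s (v 1) = 0 /\ t (v 0) - t (v 1) = 0.
  apply: (rotation_eq0 ab).
    by have := ev 0; have := ev 1; lra.
  by move: r01; rewrite /r; lra.
have v01 : v 0 = v 1.
  by apply: coords_inj => //; apply/eqP; rewrite -subr_eq0 ?ds ?dt.
have [||] := @affinely_independent3 _ _ v 1 (-1) 0 ind.
- by ring.
- by rewrite v01 scale1r scaleN1r scale0r addr0 subrr.
by move/eqP; rewrite oner_eq0.
Qed.

(** Both supporting lines pass through [p] and [q], so their normals are parallel. *)
Lemma facet_eq F G p q : is_facet P F -> is_facet P G -> p != q ->
  F p -> F q -> G p -> G q -> F = G.
Proof.
move=> /is_facetP[a [b [c [ab [_ FE] _]]]] /is_facetP[a' [b' [c' [ab' [_ GE] _]]]] pq.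
rewrite FE GE => -[Pp Fp] [Pq Fq] [_ Gp] [_ Gq].
have D : (s p - s q != 0) || (t p - t q != 0).
  rewrite -negb_and; apply: contra pq => /andP[]; rewrite !subr_eq0 => /eqP es /eqP et.
  by apply/eqP/coords_inj.
have det : a * b' = a' * b by apply: (parallel_det D); lra.
apply/seteqP; split=> y [Py e]; split=> //.
  suff : a' * (s y - s p) + b' * (t y - t p) = 0 by lra.
  by apply: (parallel_eq0 ab det); lra.
suff : a * (s y - s p) + b * (t y - t p) = 0 by lra.
by apply: (parallel_eq0 ab' (esym det)); lra.
Qed.

(* The face is given by [a s + b t = c], so [- b s + a t] is a coordinate along it.
   Adding a small multiple of this coordinate to the functional of the face exposes
   its endpoint; the sign of [k] selects which one. *)
Lemma facet_endpoint F a b c k : (a != 0) || (b != 0) -> exposed_by F a b c ->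
  F !=set0 -> k != 0 ->
  exists p, [/\ is_vertex P p, F p &
    forall y, F y -> k * (- b * s y + a * t y) <= k * (- b * s p + a * t p)].
Proof.
move=> ab [le ->] [y0 [Py0 ey0]] k0 /=.
pose g y := a * s y + b * t y; pose f y := k * (- b * s y + a * t y).
have gle i : dotp (a *: u + b *: w) (x i) <= c.
  by rewrite dotp_comb; apply/le/conv_hull_mem.
have supp (l : 'I_m -> R) i : (forall j, 0 <= l j) -> \sum_j l j = 1 ->
    g (\sum_j l j *: x j) = c -> l i != 0 -> g (x i) == c.
  move=> l0 l1 e li; rewrite /g -dotp_comb; apply/eqP.
  by apply: conv_hull_support li => //; rewrite dotp_comb.
have [i0 gi0] : exists i, g (x i) == c.
  have [l [l0 l1 ey]] := Py0; rewrite ey in ey0.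
  apply: contrapT => n; suff : \sum_i l i = 0 by rewrite l1 => /eqP; rewrite oner_eq0.
  apply: big1 => i _; apply/eqP/negPn/negP => li; apply: n; exists i.
  exact: supp li.
have [i gi max] := @arg_maxP _ _ _ i0 (fun i => g (x i) == c) (fun i => f (x i)) gi0.
(* [e] is so small that the generators off the face stay strictly below the tilted value at
   [x i]. *)
have [e e0 small] := @small_eps R _ (fun j => g (x j) != c)
  (fun j => c - g (x j)) (fun j => f (x j) - f (x i))
  (fun j h => ltac:(by rewrite subr_gt0 lt_neqAle h /g -dotp_comb gle)).
exists (x i); split; last 2 first.
- by split; [apply: conv_hull_mem | apply/eqP].
- move=> _ [[l [l0 l1 ->]] ey]; rewrite -/(f _) -/(f (x i)).
  rewrite -[f (x i)]mul1r -l1 mulr_suml {1}/f !dotp_sum !mulr_sumr -big_split mulr_sumr /=.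
  apply: ler_sum => j _; have [->|lj] := eqVneq (l j) 0;
    first by rewrite !mul0r !mulr0 addr0 mulr0.
  rewrite (_ : k * _ = l j * f (x j)); last by rewrite /f; ring.
  by apply: ler_wpM2l => //; apply: max; apply: supp lj.
pose A := a - e * k * b; pose B := b + e * k * a; pose C := c + e * f (x i).
have AB y : A * s y + B * t y = g y + e * f y by rewrite /A /B /g /f; ring.
have ABle j : A * s (x j) + B * t (x j) <= C.
  rewrite AB /C; have [ej|nj] := eqVneq (g (x j)) c.
    by rewrite ej lerD2l ler_pM2l //; apply: max; rewrite ej.
  by have := small j nj; lra.
apply/is_faceP; exists A, B, C; apply: exposed_gen => //.
apply/seteqP; split=> [_ ->|y [Py ey]] /=.
  by split; [apply: conv_hull_mem | rewrite AB /C (eqP gi)].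
apply/eqP/negPn/negP => yp.
have [||j [jp]] := @conv_hull_face _ _ _ x (A *: u + B *: w) C y (x i) _ Py _ yp.
- by move=> j; rewrite dotp_comb ABle.
- by rewrite dotp_comb.
rewrite dotp_comb AB /C; have [ej|nj] := eqVneq (g (x j)) c; last first.
  by have := small j nj; lra.
rewrite ej => /addrI/(mulfI (lt0r_neq0 e0))/(mulfI k0) ef.
case/eqP: jp; have [ds dt] : s (x j) - s (x i) = 0 /\ t (x j) - t (x i) = 0.
  apply: (rotation_eq0 ab); last by move: ef; lra.
  by move: ej (eqP gi); rewrite /g; lra.
by apply: coords_inj; try exact: conv_hull_mem; apply/eqP; rewrite -subr_eq0 ?ds ?dt.
Qed.

Lemma vertex_functional p : is_vertex P p -> exists a b,
  forall y, P y -> y != p -> a * s y + b * t y < a * s p + b * t p.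
Proof.
move=> vp; have Pp := vertex_mem vp; move: vp => /is_faceP[a [b [c [le E]]]].
exists a, b => y Py yp; have : [set p] p by []; rewrite E => -[_ ->].
rewrite lt_neqAle le // andbT; apply: contra yp => /eqP e; apply/eqP.
by have : [set y | P y /\ a * s y + b * t y = c] y by []; rewrite -E.
Qed.

(** The endpoints in the two directions along the edge are vertices. A third vertex would lie
    strictly between them, where no affine function on the edge has a strict maximum. *)
Lemma facet_two_vertices F : is_facet P F -> exists p q,
  [/\ p != q, is_vertex P p /\ F p, is_vertex P q /\ F q &
    forall v, is_vertex P v -> F v -> v = p \/ v = q].
Proof.
move=> /is_facetP[a [b [c [ab eF [y [z [Fy Fz yz]]]]]]].
have F0 : F !=set0 by exists y.
pose Z v := - b * s v + a * t v.
have onF v v' : F v -> F v' -> a * (s v - s v') + b * (t v - t v') = 0.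
  by rewrite eF.2 => -[_ h] [_ h']; lra.
have FP v : F v -> P v by rewrite eF.2 => -[].
have Zinj v v' : F v -> F v' -> Z v = Z v' -> v = v'.
  move=> Fv Fv' e; have [ds dt] : s v - s v' = 0 /\ t v - t v' = 0.
    by apply: (rotation_eq0 ab); [exact: onF | move: e; rewrite /Z; lra].
  by apply: coords_inj; try exact: FP; apply/eqP; rewrite -subr_eq0 ?ds ?dt.
have [p [vp Fp max]] := facet_endpoint ab eF F0 (oner_neq0 R).
have [|q [vq Fq min]] := @facet_endpoint F a b c (-1) ab eF F0;
  first by rewrite oppr_eq0 oner_neq0.
have {}max v : F v -> Z v <= Z p by move/max; rewrite !mul1r.
have {}min v : F v -> Z q <= Z v by move/min; rewrite !mulN1r lerN2.
exists p, q; split=> // [|v vv Fv].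
  apply/eqP => pq; case/eqP: yz; apply: Zinj => //.
  have := max _ Fy; have := min _ Fy; have := max _ Fz; have := min _ Fz.
  by rewrite pq; lra.
apply: contrapT => /not_orP[/eqP vp' /eqP vq'].
have [a' [b' lt]] := vertex_functional vv.
(* Along the edge the functional exposing [v] depends linearly on [Z], so it cannot decrease on both
   sides of [v]. *)
have rel v' : F v' -> (a ^+ 2 + b ^+ 2) * (a' * (s v' - s v) + b' * (t v' - t v)) =
    (b' * a - a' * b) * (Z v' - Z v).
  move=> Fv'; transitivity ((a' * a + b' * b) * (a * (s v' - s v) + b * (t v' - t v)) +
    (b' * a - a' * b) * (Z v' - Z v)); first by rewrite /Z; ring.
  by rewrite onF // mulr0 add0r.
have N0 : 0 < a ^+ 2 + b ^+ 2.
  by rewrite lt_neqAle addr_ge0 ?sqr_ge0 // eq_sym paddr_eq0 ?sqr_ge0 // !sqrf_eq0 negb_and ab.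
have Zp : Z v < Z p by rewrite lt_neqAle max // andbT; apply: contra vp' => /eqP/Zinj->.
have Zq : Z q < Z v by rewrite lt_neqAle min // andbT; apply: contra vq' => /eqP/Zinj->.
have lp := lt p (FP _ Fp); have lq := lt q (FP _ Fq).
rewrite eq_sym in vp'; rewrite eq_sym in vq'.
have {}lp : (b' * a - a' * b) * (Z p - Z v) < 0.
  by rewrite -rel // pmulr_rlt0 //; have := lp vp'; lra.
have {}lq : (b' * a - a' * b) * (Z q - Z v) < 0.
  by rewrite -rel // pmulr_rlt0 //; have := lq vq'; lra.
move: lp lq; rewrite pmulr_llt0 ?subr_gt0 // nmulr_llt0 ?subr_lt0 //; lra.
Qed.

(* [K / H] is the slope of a direction at [p] relative to the functional exposing [p];
   the sign [k] selects the edge of largest or of smallest slope. *)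
Lemma vertex_edge p a b k : P p -> (a != 0) || (b != 0) -> k ^+ 2 = 1 ->
  (forall y, P y -> y != p -> a * s y + b * t y < a * s p + b * t p) ->
  let H y := a * (s p - s y) + b * (t p - t y) in
  let K y := k * (- b * (s y - s p) + a * (t y - t p)) in
  exists F, [/\ is_facet P F, F p, exists2 i, x i != p & F (x i) &
    forall j, x j != p ->
     (F (x j) <-> forall i, x i != p -> K (x i) * H (x j) <= K (x j) * H (x i))].
Proof.
move=> Pp ab k1 lt H K.
have [i0 ip0] : exists i, x i != p.
  apply: contrapT => n; suff [a0 b0] : a = 0 /\ b = 0 by move: ab; rewrite a0 b0 eqxx.
  apply: (@spread_gen _ _ (a * s p + b * t p)) => i.
  by have [->//|ip] := eqVneq (x i) p; case: n; exists i.
have [i ip max] := @arg_maxP _ _ _ i0 (fun i => x i != p) (fun i => K (x i) / H (x i)) ip0.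
have H0 j : x j != p -> 0 < H (x j).
  by move=> jp; have := lt _ (conv_hull_mem x j) jp; rewrite /H; lra.
have Hp : H p = 0 by rewrite /H !subrr !mulr0 addr0.
have Kp : K p = 0 by rewrite /K !subrr !mulr0 addr0 mulr0.
pose r := K (x i) / H (x i).
have KH j : K (x j) - r * H (x j) <= 0.
  have [->|jp] := eqVneq (x j) p; first by rewrite Kp Hp mulr0 subrr.
  by rewrite subr_le0 -ler_pdivrMr ?H0 //; apply: max.
have KHi : K (x i) - r * H (x i) = 0 by rewrite /r divfK ?subrr // gt_eqF ?H0.
(* The functional is [K - r * H] up to a constant: zero at [p] and, by maximality of the slope [r],
   nonpositive on all generators. *)
pose A := - k * b + r * a; pose B := k * a + r * b; pose C := A * s p + B * t p.
have AB y : A * s y + B * t y - C = K y - r * H y  by rewrite /C /A /B /K /H; ring.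
pose F := [set y | P y /\ A * s y + B * t y = C].
have Fx y : P y -> F y <-> K y - r * H y = 0.
  by move=> Py; rewrite -AB; split=> [[_ ->]|h]; [rewrite subrr | split=> //; lra].
exists F; split.
- apply/is_facetP; exists A, B, C; split.
  + rewrite -negb_and; apply/negP => /andP[/eqP A0 /eqP B0].
    have N0 : a ^+ 2 + b ^+ 2 != 0.
      by rewrite paddr_eq0 ?sqr_ge0 // !sqrf_eq0 negb_and.
    suff : k * (a ^+ 2 + b ^+ 2) = 0.
      move/eqP; rewrite mulf_eq0 (negPf N0) orbF => /eqP k0.
      by move/eqP: k1; rewrite k0 expr0n /= eq_sym oner_eq0.
    by transitivity (B * a - A * b); [rewrite /A /B; ring | rewrite A0 B0; ring].
  + by apply: exposed_gen => // j; rewrite -subr_le0 AB KH.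
  + by exists (x i), p; split=> //; apply/Fx; rewrite ?Kp ?Hp ?mulr0 ?subrr //;
    exact: conv_hull_mem.
- by apply/Fx; rewrite ?Kp ?Hp ?mulr0 ?subrr.
- by exists i => //; apply/Fx => //; exact: conv_hull_mem.
move=> j jp; have Pj := conv_hull_mem x j.
split=> [/(Fx _ Pj) e l lp|h].
  have := KH l; rewrite (_ : K (x j) = r * H (x j)); last by lra.
  by rewrite subr_le0 [r * _ * _]mulrAC ler_pM2r ?H0.
apply/(Fx _ Pj)/eqP; rewrite eq_le KH subr_ge0 /= /r mulrAC ler_pdivrMr ?H0 //.
exact: h.
Qed.

(** The edges of largest and smallest slope differ because otherwise all generators would be
    collinear. On any other facet through [p], a generator different from [p] again has extreme
    slope. *)
Lemma vertex_two_facets p : is_vertex P p -> exists F G,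
  [/\ F != G, is_facet P F /\ F p, is_facet P G /\ G p &
    forall D, is_facet P D -> D p -> D = F \/ D = G].
Proof.
move=> vp; have Pp := vertex_mem vp; have [a [b lt]] := vertex_functional vp.
have ab : (a != 0) || (b != 0).
  rewrite -negb_and; apply/negP => /andP[/eqP a0 /eqP b0].
  have [] := @spread_gen 1 0 (s p); last by move/eqP; rewrite oner_eq0.
  move=> i; have [->|ip] := eqVneq (x i) p; first by ring.
  by have := lt _ (conv_hull_mem x i) ip; rewrite a0 b0; lra.
have [F [fF Fp [i ip Fi] EF]] := vertex_edge Pp ab (expr1n R 2) lt.
have [|G [fG Gp [i' ip' Gi'] EG]] := vertex_edge (k := -1) Pp ab _ lt.
  by rewrite sqrrN expr1n.
pose H y := a * (s p - s y) + b * (t p - t y).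
pose K y := - b * (s y - s p) + a * (t y - t p).
have {}EF j : x j != p -> (F (x j) <-> forall i, x i != p -> K (x i) * H (x j) <=
  K (x j) * H (x i)).
  by move/EF => E; split=> [/E h l /h|h]; [rewrite !mul1r | apply/E => l /h;
    rewrite !mul1r].
have {}EG j : x j != p -> (G (x j) <-> forall i, x i != p -> K (x j) * H (x i) <=
  K (x i) * H (x j)).
  by move/EG => E; split=> [/E h l /h|h]; [|apply/E => l /h];
    rewrite !mulN1r -!/(K _) !mulNr lerN2.
have H0 j : x j != p -> 0 < H (x j).
  by move=> jp; have := lt _ (conv_hull_mem x j) jp; rewrite /H; lra.
exists F, G; split=> // [|D fD Dp].
  apply/eqP => FG; move: Fi; rewrite FG => Gi.
  have hF := (EF i ip).1; rewrite FG in hF; have {}hF := hF Gi.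
  have hG := (EG i ip).1 Gi.
  (* If the edges agree, [r] is the slope of every generator, and [K = r * H] is an affine relation
     excluded by [spread_gen]. *)
  pose r := K (x i) / H (x i).
  have [|z1 z2] := @spread_gen (- b + r * a) (a + r * b) (- b * s p + a * t p + r * (a * s p + b * t p)).
    move=> j; have [->|jp] := eqVneq (x j) p; first by ring.
    have e : K (x j) * H (x i) = K (x i) * H (x j).
      by apply/eqP; rewrite eq_le hF ?hG.
    have : K (x j) = r * H (x j).
      by rewrite /r mulrAC -e mulfK // gt_eqF ?H0.
    by rewrite /K /H; lra.
  have [aN bN] : a = 0 /\ b = 0.
    have N0 : 1 + r ^+ 2 != 0 by rewrite gt_eqF // ltr_pwDl ?sqr_ge0.
    split; apply: (mulfI N0); rewrite mulr0.
      by transitivity ((a + r * b) + r * (- b + r * a)); [ring | rewrite z1 z2; ring].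
    by transitivity (r * (a + r * b) - (- b + r * a)); [ring | rewrite z1 z2; ring].
  by move: ab; rewrite aN bN eqxx.
have [a' [b' [c' [ab' [le DE] [y [z [Dy Dz yz]]]]]]] := (is_facetP D).1 fD.
have [_ ec] : P p /\ a' * s p + b' * t p = c' by move: Dp; rewrite DE.
have [v [Dv vp']] : exists v, D v /\ v != p.
  have [yp|yp] := eqVneq y p; last by exists y.
  by exists z; split=> //; rewrite -yp eq_sym.
have [j [jp ej]] : exists j, x j != p /\ dotp (a' *: u + b' *: w) (x j) = c'.
  move: Dv; rewrite DE => -[Pv ev]; apply: conv_hull_face Pv _ vp'.
    by move=> l; rewrite dotp_comb le //; exact: conv_hull_mem.
  by rewrite dotp_comb.
rewrite dotp_comb in ej.
have Dj : D (x j) by rewrite DE; split=> //; exact: conv_hull_mem.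
(* Up to a positive factor the functional of [D] is [mu * K - lam * H]. It is nonpositive on [P] and
   zero at [x j], so the sign of [mu] decides whether the slope of [x j] is largest or smallest. *)
pose lam := a' * a + b' * b; pose mu := b' * a - a' * b.
have rel y' : (a ^+ 2 + b ^+ 2) * (a' * (s y' - s p) + b' * (t y' - t p)) =
    mu * K y' - lam * H y' by rewrite /lam /mu /K /H; ring.
have N0 : 0 < a ^+ 2 + b ^+ 2.
  by rewrite lt_neqAle addr_ge0 ?sqr_ge0 // eq_sym paddr_eq0 ?sqr_ge0 // !sqrf_eq0 negb_and ab.
have relj : mu * K (x j) = lam * H (x j).
  have e0 : a' * (s (x j) - s p) + b' * (t (x j) - t p) = 0 by lra.
  by apply/eqP; rewrite -subr_eq0 -rel e0 mulr0.
have reli l : mu * K (x l) <= lam * H (x l).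
  by rewrite -subr_le0 -rel pmulr_rle0 //; have := le _ (conv_hull_mem x l); lra.
have slopes l : x l != p -> mu * (K (x l) * H (x j)) <= mu * (K (x j) * H (x l)).
  move=> lp; rewrite (mulrA mu (K (x l))) (mulrA mu (K (x j))) relj.
  by rewrite [lam * _ * _]mulrAC ler_pM2r ?H0.
have [mu0|mu0|mu0] := ltrgtP mu 0.
- right; apply: (facet_eq fD fG jp) => //; apply/EG => // l /slopes.
  by rewrite ler_nM2l.
- left; apply: (facet_eq fD fF jp) => //; apply/EF => // l /slopes.
  by rewrite ler_pM2l.
have l0 : lam = 0.
  by apply: (mulIf (lt0r_neq0 (H0 _ jp))); rewrite -relj mu0 !mul0r.
suff [a0 b0] : a' = 0 /\ b' = 0 by move: ab'; rewrite a0 b0 eqxx.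
apply: (rotation_eq0 ab); first by rewrite -[RHS]l0 /lam; ring.
  by rewrite -[RHS]mu0 /mu; ring.
Qed.

End Polygon.

(** * Rectangle covers of slack matrices *)

Section RectangleCover.
Variables (R : realType) (f v : nat) (M : 'M[R]_(f, v)).
Variable D : {set {set 'I_f} * {set 'I_v}}.
Hypothesis coverD : is_rectangle_cover M D.
Local Notation T := {Q : {set 'I_f} * {set 'I_v} | Q \in D}.

(** These are the vertex sets and facet sets of the counting argument; the ground set is the cover
    itself, as a subtype. *)
Definition column_rectangles j : {set T} := [set Q : T | j \in (val Q).2]%SET.
Definition row_avoiding_rectangles i : {set T} := [set Q : T | i \notin (val Q).1]%SET.

(** Inclusion fails exactly when some rectangle of the cover contains the entry, that is, when the
    entry is positive. *)
Lemma column_rectangles_subset j i :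
  (column_rectangles j \subset row_avoiding_rectangles i) = ~~ (0 < M i j).
Proof.
have [rect cov] := andP coverD.
apply/idP/idP => [/fintype.subsetP sub|].
  apply/negP => Mij; have /exists_inP[Q QD /andP[Qi Qj]] :=
    implyP (forallP (forallP cov i) j) Mij.
  by have := sub (exist _ Q QD); rewrite !inE /= Qi Qj => /(_ isT).
apply: contraR => /fintype.subsetPn[[Q QD]]; rewrite !inE negbK /= => Qj Qi.
exact: (forall_inP (forall_inP (forall_inP rect _ QD) _ Qi) _ Qj).
Qed.

(** A single rectangle containing both positive entries would also contain the zero entry
    [(i, j)]. *)
Lemma card_cover_gt1 i j k l : 0 < M i l -> 0 < M k j -> M i j = 0 -> (1 < #|D|)%N.
Proof.
have [rect cov] := andP coverD => Mil Mkj Mij.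
have /exists_inP[Q QD /andP[Qi Ql]] := implyP (forallP (forallP cov i) l) Mil.
have /exists_inP[Q' QD' /andP[Qk Qj]] := implyP (forallP (forallP cov k) j) Mkj.
apply/card_gt1P; exists Q, Q'; split=> //; apply/eqP => e; subst Q'.
have := forall_inP (forall_inP (forall_inP rect _ QD) _ Qi) _ Qj.
by rewrite Mij ltxx.
Qed.

End RectangleCover.

Lemma card_pair_eq2 (I : finType) (a : pred I) i k : i != k -> a i -> a k ->
  (forall l, a l -> l = i \/ l = k) -> #|[set l | a l]%SET| = 2.
Proof.
move=> ik ai ak al; have -> : [set l | a l]%SET = [set i; k]%SET.
  apply/finset.setP => l; rewrite !inE; apply/idP/orP => [/al[]->|[] /eqP-> //];
    rewrite eqxx; auto.
by rewrite cards2 ik.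
Qed.

Lemma vertex_is_facet (R : realType) (d : nat) (P : set 'cV[R]_d) p :
  has_dim P 1 -> is_vertex P p -> is_facet P [set p].
Proof.
move=> dP vp; split=> //; exists 0%N; split=> //; split.
  exists (fun=> p); split=> // c; rewrite big_ord_recl big_ord0 addr0 => c0 _ i.
  by rewrite (ord1 i).
move=> [x [xp ind]]; suff : (1 : R) = 0 by move/eqP; rewrite oner_eq0.
apply: (ind (fun i => if i == 0 then 1 else -1) _ _ 0).
  by rewrite !big_ord_recl big_ord0 /= addr0 subrr.
by rewrite !big_ord_recl big_ord0 /= addr0 !xp scale1r scaleN1r subrr.
Qed.

(** * Slack matrices of polygons and segments *)

Section SlackMatrix.
Variables (R : realType) (d f v : nat) (P : set 'cV[R]_d) (S : 'M[R]_(f, v)).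
Variables (a : 'I_f -> 'cV[R]_d) (b : 'I_f -> R) (x : 'I_v -> 'cV[R]_d).
Hypothesis valid : forall i, valid_ineq P (a i) (b i).
Hypothesis facets : set_bij [set: 'I_f] [set F | is_facet P F]
  (fun i => face_of P (a i) (b i)).
Hypothesis vertices : set_bij [set: 'I_v] [set p | is_vertex P p] x.
Hypothesis slack : forall i j, S i j = b i - dotp (a i) (x j).
Local Notation facet i := (face_of P (a i) (b i)).

Lemma vertexP j : is_vertex P (x j).
Proof. by case: vertices => h _ _; apply: h. Qed.

Lemma vertex_inj j k : x j = x k -> j = k.
Proof. by case: vertices => _ h _; apply: h; rewrite inE. Qed.

Lemma vertex_surj p : is_vertex P p -> exists j, p = x j.
Proof. by case: vertices => _ _ h /h[j _ <-]; exists j. Qed.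

Lemma facetP i : is_facet P (facet i).
Proof. by case: facets => h _ _; apply: (h i). Qed.

Lemma facet_inj i k : facet i = facet k -> i = k.
Proof. by case: facets => _ h _; apply: h; rewrite inE. Qed.

Lemma facet_surj F : is_facet P F -> exists i, F = facet i.
Proof. by case: facets => _ _ h /h[i _ <-]; exists i. Qed.

Lemma slack_gt0 i j : ~~ (0 < S i j) <-> facet i (x j).
Proof.
have Px : P (x j) by apply: vertex_mem (vertexP j).
rewrite slack subr_gt0 -leNgt; split=> [le|[_ /= ->] //].
by split=> //; apply/eqP; rewrite eq_le le valid.
Qed.

Lemma card_slack_columns n : ([set p | is_vertex P p] #= `I_n)%card -> v = n.
Proof.
move=> cP; apply/card_eq_II; apply: card_eq_trans cP.
apply: card_eq_trans card_II _; rewrite card_eq_sym.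
have -> : [set p | is_vertex P p] = x @` [set: 'I_v].
  by apply/seteqP; split=> p /= => [/vertex_surj[j ->]|[j _ <-]];
    [exists j | apply: vertexP].
by apply: inj_card_eq; case: vertices.
Qed.

(** The geometry supplies the hypotheses of [card_vertices_leq], with incidence read off as
    vanishing slack. *)
Lemma polygon_bound D : polytope P -> has_dim P 2 -> (2 < v)%N ->
  is_rectangle_cover S D ->
  (1 < #|D|)%N /\ (v * #|D|.-1 <= #|D| * 'C(#|D|.-1, #|D| %/ 2))%N.
Proof.
move=> [m [y PE]] dP v3 coverD; have [o [e1 [e2 [u [w [coords spread]]]]]] :=
  has_dim2_coords dP.
have dP' := dP; rewrite PE in dP' coords spread.
have cD : #|{: {Q | Q \in D}}| = #|D| by rewrite card_sig; apply: eq_card => Q;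
  rewrite inE.
have facet2 i : #|[set j | ~~ (0 < S i j)]%SET| = 2.
  have fi := facetP i; rewrite PE in fi.
  have [p [q [pq [vp Fp] [vq Fq] uniq]]] := facet_two_vertices dP' coords fi.
  rewrite -PE in vp Fp vq Fq uniq.
  have [j ej] := vertex_surj vp; have [k ek] := vertex_surj vq; subst p q.
  apply: (@card_pair_eq2 _ _ j k); [|exact/slack_gt0|exact/slack_gt0|].
    by apply: contra pq => /eqP->.
  by move=> l /slack_gt0 /(uniq _ (vertexP l))[]/vertex_inj; [left|right].
have vertex2 j : #|[set i | ~~ (0 < S i j)]%SET| = 2.
  have vj := vertexP j; rewrite PE in vj.
  have [F [G [FG [fF Fj] [fG Gj] uniq]]] := vertex_two_facets dP' coords spread vj.
  rewrite -PE in fF fG uniq.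
  have [i ei] := facet_surj fF; have [k ek] := facet_surj fG; subst F G.
  apply: (@card_pair_eq2 _ _ i k); [|exact/slack_gt0|exact/slack_gt0|].
    by apply: contra FG => /eqP->.
  by move=> l /slack_gt0 /(uniq _ (facetP l))[]/facet_inj; [left|right].
have share i k j l : j != l -> ~~ (0 < S i j) -> ~~ (0 < S i l) ->
    ~~ (0 < S k j) -> ~~ (0 < S k l) -> i = k.
  move=> jl /slack_gt0 ij /slack_gt0 il /slack_gt0 kj /slack_gt0 kl.
  apply: facet_inj; have fi := facetP i; have fk := facetP k; rewrite PE in fi fk.
  rewrite PE; apply: (facet_eq dP' coords fi fk (_ : x j != x l)); rewrite -?PE //.
  by apply: contra jl => /eqP/vertex_inj->.
have v3' : (2 < #|'I_v|)%N by rewrite card_ord.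
have sub := column_rectangles_subset coverD.
have := card_vertices_leq sub facet2 vertex2 share v3'.
have := card_ground_gt2 sub facet2 vertex2 share v3'.
by rewrite cD card_ord => D2 le; split=> //; apply: ltnW.
Qed.

(** Each endpoint is also a facet, with zero slack at itself and positive slack at the other
    endpoint. *)
Lemma segment_cover D : has_dim P 1 -> v = 2 -> is_rectangle_cover S D -> (1 < #|D|)%N.
Proof.
move=> dP v2 coverD; have [j [l jl]] : exists j l : 'I_v, j != l.
  by move: v2; case: v => [|[|[|]]] // _; exists ord0, ord_max.
have facet_of k : exists i, facet i = [set x k].
  by have [i ei] := facet_surj (vertex_is_facet dP (vertexP k)); exists i.
have [i ei] := facet_of j; have [k ek] := facet_of l.
have neq y z h : facet h = [set x y] -> y != z -> 0 < S h z.
  move=> eh yz; apply/negPn/negP => /slack_gt0; rewrite eh => /vertex_inj zy.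
  by rewrite zy eqxx in yz.
apply: (card_cover_gt1 coverD (neq j l i ei jl) (neq l j k ek _));
  first by rewrite eq_sym.
have [_ /= h] : facet i (x j) by rewrite ei.
by rewrite slack h subrr.
Qed.

End SlackMatrix.

Lemma bin_quotient_bound (R : realType) (n r : nat) : (1 < r)%N ->
  (n * r.-1 <= r * 'C(r.-1, r %/ 2))%N ->
  n%:R <= (r%:R - (r %/ 2)%:R) / (r%:R - 1) * 'C(r, r %/ 2)%:R :> R.
Proof.
move=> r1 le; have r2 : (r %/ 2 <= r)%N by apply: leq_div.
rewrite mulrAC ler_pdivlMr ?subr_gt0 ?ltr1n //.
by rewrite -[1]/(1%:R) -!natrB ?(ltnW r1) // -!natrM ler_nat subn1 -mul_bin_down.
Qed.

Theorem corollary3 (R : realType) (d n f v r : nat) (P : set 'cV[R]_d)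
    (S : 'M[R]_(f, v)) :
  (2 <= n)%N ->
  is_ngon n P ->
  is_slack_matrix P S ->
  r = rectangle_covering_number S ->
  n%:R <= (r%:R - (r %/ 2)%:R) / (r%:R - 1) * 'C(r, r %/ 2)%:R :> R.
Proof.
move=> n2 [polyP dimP cardP] [a [b [x [valid facets vertices slack]]]].
have vn := card_slack_columns vertices cardP; subst n.
rewrite /rectangle_covering_number.
case: arg_minnP => [|D coverD _ ->]; first exact: all_rectangles_cover.
move: dimP; case: eqVneq => [v2 dimP|vn2 dimP]; last first.
  have v3 : (2 < v)%N by lia.
  have [D1 le] := polygon_bound valid facets vertices slack polyP dimP v3 coverD.
  exact: bin_quotient_bound.
have D1 := segment_cover valid facets vertices slack dimP v2 coverD.
apply: bin_quotient_bound => //; move: #|D| D1 => k k1.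
(* For a segment, [2 <= k] and [k - 1], a binomial of row [k - 1], is at most the central one; the
   product of the two estimates is the required bound. *)
have := bin_max k.-1 1; rewrite bin1 (_ : k.-1.+1 = k); last lia.
by rewrite v2 => h; apply: leq_mul.
Qed.
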